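(* Let $H_1$ and $H_2$ be orthomodular spaces over the sfields $F_1$ and $F_2$, respectively. Let $\phi \colon H_1 \to H_2$ be a partial quasiisometry and let $f = \mathbf P(\phi)\colon \mathbf P(H_1)\to\mathbf P(H_2)$, $\langle u\rangle\mapsto\langle\phi(u)\rangle$. Then there is an orthomodular space $H_2'$ over $F_1$ and an orthoisomorphism $t \colon \mathbf P(H_2) \to \mathbf P(H_2')$ such that $t \circ f$ is induced by a partial isometry from $H_1$ to $H_2'$; that is, there is a partial isometry $\phi'\colon H_1\to H_2'$ with $t(f(\langle u\rangle))=\langle\phi'(u)\rangle$ for all $u\in H_1$.
   Context: A sfield is a skew field (division ring). A $\ast$-sfield is a sfield $F$ with an involutory antiautomorphism $\ast \colon F \to F$. A Hermitian space over a $\ast$-sfield $F$ is a (left) linear space $H$ over $F$ with a map $(\cdot,\cdot)\colon H\times H\to F$ such that $(\alpha u+\beta v,w)=\alpha(u,w)+\beta(v,w)$, $(w,\alpha u+\beta v)=(w,u)\alpha^\ast+(w,v)\beta^\ast$, $(u,v)=(v,u)^\ast$ for all $u,v,w\in H$, $\alpha,\beta\in F$, and which is anisotropic: $(u,u)=0$ implies $u=0$. We write $u\perp v$ if $(u,v)=0$. Standing assumption: a Hermitian space contains at most countably many mutually orthogonal nonzero vectors. ''Over the sfield $F$'' means that the scalar sfield is $F$, equipped with some involutory antiautomorphism. A linear subspace $S$ of $H$ is orthoclosed if $S=S^{\perp\perp}$, where $S^\perp=\{u\in H:u\perp v\text{ for all }v\in S\}$, and splitting if $H$ is the direct sum of $S$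 and $S^\perp$. An orthomodular space is a Hermitian space in which every orthoclosed subspace is splitting. Subspaces carry the inherited Hermitian form. A map $\phi$ between linear spaces over $F_1$ and $F_2$ is quasilinear with associated isomorphism $\sigma$ if it is additive and $\sigma\colon F_1\to F_2$ is an isomorphism of sfields with $\phi(\alpha u)=\alpha^\sigma\phi(u)$ for all $u$ and $\alpha\in F_1$. A bijection $\phi$ between Hermitian spaces over $F_1$ and $F_2$ is quasiunitary if it is quasilinear with associated isomorphism $\sigma$ and there is a $\lambda\in F_2\setminus\{0\}$ such that $(\phi(u),\phi(v))_2={(u,v)_1}^\sigma\,\lambda$ for all $u,v$; if $F_1=F_2$, $\sigma$ is the identity and $\lambda=1$, it is unitary. A partial quasiisometry between orthomodular spaces $H_1$, $H_2$ is a quasilinear map $\phi\colon H_1\to H_2$ for which there are orthoclosed subspaces $S_1$ of $H_1$ and $S_2$ of $H_2$ such that $\ker\phi=S_1^\perp$, $\operatorname{im}\phi=S_2$, and the restriction of $\phi$ to a map $S_1\to S_2$ is quasiunitary. If $\phi$ is linear and this restriction is unitary, $\phi$ is a partial isometry. An orthoset is a set $X$ with a symmetric binary relation $\perp$ and a constant $0$ such that $x\perp x$ if and only if $x=0$, and $0\perp x$ for all $x\in X$. An orthoisomorphism between orthosets is a bijection $t\colon X\to Y$ such that $x\perp y$ if and only if $t(x)\perp t(y)$, for all $x,y\in X$. For a Hermitian space $H$, $\mathbf P(H)=\{\langle u\rangle: u\in H\}$ is the set of at most one-dimensional subspaces of $H$ ($\langle u\rangle$ denotes the linear span of $u$), viewed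 as an orthoset with $\langle u\rangle\perp\langle v\rangle$ if $u\perp v$ and with the zero subspace $\{0\}$ as the constant $0$. *)

(* Defs.v *)
From HB Require Import structures.
From mathcomp Require Import all_boot all_order all_algebra.
From mathcomp Require Import boolp classical_sets functions cardinality.

Set Implicit Arguments.
Unset Strict Implicit.
Unset Printing Implicit Defensive.

Import GRing.Theory.
Local Open Scope ring_scope.
Local Open Scope classical_set_scope.

HB.mixin Record isSfield (F : Type) of GRing.UnitRing F := {
  sfieldP : forall x : F, x != 0 -> x \is a GRing.unit
}.

#[short(type="sfieldType")]
HB.structure Definition Sfield := {F of isSfield F & GRing.UnitRing F}.

(* Injectivity and [s 1 = 1] follow from these three conditions. *)
Definition involutory_antiautomorphism (F : sfieldType) (s : F -> F) : Prop :=
  [/\ {morph s : a b / a + b},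
      forall a b, s (a * b) = s b * s a &
      forall a, s (s a) = a].

(* The involution belongs to the space and not to the scalars, so that two
   Hermitian spaces over the same sfield may carry different involutions. *)
Record hermitianSpace (F : sfieldType) := HermitianSpace {
  hs_space :> lmodType F;
  hs_star : F -> F;
  hs_form : hs_space -> hs_space -> F;
  hs_starP : involutory_antiautomorphism hs_star;
  hs_forml : forall (a b : F) (u v w : hs_space),
    hs_form (a *: u + b *: v) w = a * hs_form u w + b * hs_form v w;
  hs_formr : forall (a b : F) (u v w : hs_space),
    hs_form w (a *: u + b *: v) =
      hs_form w u * hs_star a + hs_form w v * hs_star b;
  hs_formC : forall u v : hs_space, hs_form u v = hs_star (hs_form v u);
  hs_anisotropic : forall u : hs_space, hs_form u u = 0 -> u = 0;
  hs_countable : forall A : set hs_space,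
    (forall u, A u -> u <> 0) ->
    (forall u v, A u -> A v -> u <> v -> hs_form u v = 0) ->
    countable A
}.

Section Subspaces.
Variables (F : sfieldType) (H : hermitianSpace F).
Implicit Types (u v : H) (S : set H).

Definition horth u v : Prop := hs_form u v = 0.

Definition linear_subspace S : Prop :=
  S 0 /\ forall (a b : F) u v, S u -> S v -> S (a *: u + b *: v).

Definition orthocomp S : set H := [set u | forall v, S v -> horth u v].

Definition orthoclosed S : Prop :=
  linear_subspace S /\ S = orthocomp (orthocomp S).

Definition splitting S : Prop :=
  S `&` orthocomp S = [set 0] /\
  forall w, exists u v, [/\ S u, orthocomp S v & w = u + v].

Definition orthomodular : Prop := forall S, orthoclosed S -> splitting S.

Definition hspan u : set H := [set a *: u | a in [set: F]].

Lemma hspan_id u : hspan u u.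
Proof. by exists 1 => //; rewrite scale1r. Qed.

Lemma hform0l v : hs_form 0 v = 0.
Proof. by have := hs_forml 0 0 0 0 v; rewrite !scale0r addr0 !mul0r addr0. Qed.

Lemma horthC u v : horth u v -> horth v u.
Proof.
have [starD _ _] := hs_starP H; have star0 : hs_star H 0 = 0.
  by apply: (addrI (hs_star H 0)); rewrite -starD !addr0.
by rewrite /horth hs_formC => /(congr1 (hs_star H)); rewrite -!hs_formC star0.
Qed.

Lemma horth_span_self u v : hspan u = hspan v -> horth u v -> u = 0.
Proof.
move=> uv ov; apply: hs_anisotropic.
have : hspan v u by rewrite -uv; exact: hspan_id.
case=> a _ <-; have := hs_forml a 0 v 0 (a *: v).
rewrite scale0r addr0 mul0r addr0 => ->; case: (eqVneq a 0) => [->|a0].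
  by rewrite mul0r.
have := hspan_id v; rewrite -uv => -[b _ bu]; rewrite -{1}bu.
have := hs_formr a 0 v 0 (b *: u); rewrite scale0r addr0 => ->.
have := hs_forml b 0 u 0 v; rewrite scale0r addr0 mul0r addr0 => ->.
have := hs_forml b 0 u 0 0; rewrite scale0r addr0 mul0r addr0 => ->.
have -> : hs_form u 0 = 0 by apply: horthC; rewrite /horth hform0l.
by rewrite ov !(mulr0, mul0r, addr0).
Qed.

End Subspaces.

Record orthoset := Orthoset {
  os_carrier :> Type;
  os_perp : os_carrier -> os_carrier -> Prop;
  os_zero : os_carrier;
  os_perp_sym : forall x y, os_perp x y -> os_perp y x;
  os_perp_self : forall x, os_perp x x <-> x = os_zero;
  os_perp_zero : forall x, os_perp os_zero x
}.

Definition orthoisomorphism (X Y : orthoset) (t : X -> Y) : Prop :=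
  bijective t /\ forall x y : X, os_perp x y <-> os_perp (t x) (t y).

Section Projective.
Variables (F : sfieldType) (H : hermitianSpace F).

Definition proj : Type := {L : set H | exists u, L = hspan u}.

Definition ray (u : H) : proj :=
  exist (fun L => exists u, L = hspan u) (hspan u) (ex_intro _ u erefl).

Definition proj_perp (x y : proj) : Prop :=
  exists u v, [/\ x = ray u, y = ray v & horth u v].

Lemma proj_ray (x : proj) : exists u, x = ray u.
Proof. by case: x => L [u Lu]; exists u; apply: eq_exist. Qed.

Lemma proj_perp_sym x y : proj_perp x y -> proj_perp y x.
Proof. by move=> [u [v [-> -> /horthC vu]]]; exists v, u. Qed.

Lemma proj_perp_self x : proj_perp x x <-> x = ray 0.
Proof.
split=> [[u [v [xu xv uv]]]|->].
  rewrite xu; congr ray; apply: horth_span_self uv.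
  by move: xv; rewrite xu => /(congr1 sval).
by exists 0, 0; split=> //; exact: hform0l.
Qed.

Lemma proj_perp_zero x : proj_perp (ray 0) x.
Proof. by have [u ->] := proj_ray x; exists 0, u; split=> //; exact: hform0l. Qed.

Definition PP : orthoset :=
  Orthoset proj_perp_sym proj_perp_self proj_perp_zero.

End Projective.

Section Maps.
Variables (F1 F2 : sfieldType) (H1 : hermitianSpace F1) (H2 : hermitianSpace F2).
Implicit Types (sigma : {rmorphism F1 -> F2}) (phi : H1 -> H2).

(* Properties of the restriction of [phi] to a subspace [S] are expressed
   relative to [S]; the form on [S] is the inherited one. *)
Definition quasilinear_on (S : set H1) sigma phi : Prop :=
  [/\ bijective sigma,
      forall u v, S u -> S v -> phi (u + v) = phi u + phi v &
      forall a u, S u -> phi (a *: u) = sigma a *: phi u].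

Definition quasilinear phi : Prop :=
  exists sigma, quasilinear_on [set: H1] sigma phi.

Definition quasiunitary_on_for (S1 : set H1) (S2 : set H2) sigma (lambda : F2)
    phi : Prop :=
  [/\ set_bij S1 S2 phi,
      quasilinear_on S1 sigma phi &
      forall u v, S1 u -> S1 v ->
        hs_form (phi u) (phi v) = sigma (hs_form u v) * lambda].

Definition quasiunitary_on (S1 : set H1) (S2 : set H2) phi : Prop :=
  exists sigma lambda, lambda != 0 /\ quasiunitary_on_for S1 S2 sigma lambda phi.

Definition partial_quasiisometry phi : Prop :=
  quasilinear phi /\
  exists (S1 : set H1) (S2 : set H2),
    [/\ orthoclosed S1, orthoclosed S2,
        [set u | phi u = 0] = orthocomp S1,
        range phi = S2 &
        quasiunitary_on S1 S2 phi].

Lemma quasilinear_image_hspan phi : quasilinear phi ->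
  forall u, phi @` hspan u = hspan (phi u).
Proof.
move=> [sigma [[tau sK tK] _ phiZ]] u.
apply/seteqP; split=> [_ [_ [a _ <-] <-]|_ [b _ <-]].
  by exists (sigma a) => //; rewrite phiZ.
by exists (tau b *: u); [exists (tau b)|rewrite phiZ// tK].
Qed.

Lemma quasilinear_image_ray phi : quasilinear phi ->
  forall L : set H1, (exists u, L = hspan u) -> exists v, phi @` L = hspan v.
Proof.
by move=> phiQ _ [u ->]; exists (phi u); exact: quasilinear_image_hspan.
Qed.

Definition PPmap phi (phiQ : quasilinear phi) (x : PP H1) : PP H2 :=
  exist (fun L => exists v, L = hspan v) (phi @` sval x)
    (quasilinear_image_ray phiQ (svalP x)).

Lemma PPmap_ray phi (phiQ : quasilinear phi) (u : H1) :
  PPmap phiQ (ray u) = ray (phi u).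
Proof. by apply: eq_exist; exact: quasilinear_image_hspan. Qed.

End Maps.

Section PartialIsometry.
Variables (F : sfieldType) (H1 H2 : hermitianSpace F).

Definition unitary_on (S1 : set H1) (S2 : set H2) (phi : H1 -> H2) : Prop :=
  quasiunitary_on_for S1 S2 idfun 1 phi.

Definition partial_isometry (phi : H1 -> H2) : Prop :=
  linear phi /\
  exists (S1 : set H1) (S2 : set H2),
    [/\ orthoclosed S1, orthoclosed S2,
        [set u | phi u = 0] = orthocomp S1,
        range phi = S2 &
        unitary_on S1 S2 phi].

Lemma partial_isometry_quasi phi :
  partial_isometry phi -> partial_quasiisometry phi.
Proof.
move=> [phiL [S1 [S2 [c1 c2 k1 i2 uS]]]]; split.
  have phiD u v : phi (u + v) = phi u + phi v.
    by have := phiL 1 u v; rewrite !scale1r.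
  have phi0 : phi 0 = 0 by apply: (addrI (phi 0)); rewrite -phiD !addr0.
  exists idfun; split=> [|u v _ _|a u _]; first by exists idfun.
    exact: phiD.
  by have := phiL a u 0; rewrite phi0 !addr0.
by exists S1, S2; split=> //; exists idfun, 1; split=> //; exact: oner_neq0.
Qed.

End PartialIsometry.

(* Main.v *)
Require Import Defs.
From HB Require Import structures.
From mathcomp Require Import all_boot all_order all_algebra.
From mathcomp Require Import boolp classical_sets functions cardinality.

(** The space [H2'] is [H2] itself, with scalars restricted along [sigma] and
    with the form [sigma^-1 ((u, v) * lambda^-1)]: this makes [phi] linear and
    isometric on [S1], and changes neither orthogonality nor the
    one-dimensional subspaces.  The new form is Hermitian because [lambda] is
    fixed by the involution: evaluating [(phi u, a phi v)] in two ways gives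
    [sigma (a^* ) = lambda (sigma a)^* lambda^-1] as soon as [S1] is nonzero,
    and the symmetry of both forms then forces [lambda^* = lambda].  If [S1] is
    zero, so is [phi], and [lambda] may be replaced by [1]. *)

Set Implicit Arguments.
Unset Strict Implicit.
Unset Printing Implicit Defensive.

Import GRing.Theory.
Local Open Scope ring_scope.
Local Open Scope classical_set_scope.

(** * Involutory antiautomorphisms and restriction of scalars *)

Section InvolutoryAntiautomorphism.
Variables (F : sfieldType) (s : F -> F).
Hypothesis sP : involutory_antiautomorphism s.

Lemma antiaut0 : s 0 = 0.
Proof. by case: sP => sD _ _; apply: (addrI (s 0)); rewrite -sD !addr0. Qed.

Lemma antiaut1 : s 1 = 1.
Proof.
(* Apply [s] to [s (1 * s 1) = s (s 1) * s 1]: the left side becomes [s 1] and the right side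
   [1]. *)
case: sP => _ sM sK; have /(congr1 s) := sM 1 (s 1).
by rewrite !(sK, mul1r, mulr1) => ->.
Qed.

Lemma antiautV x : x != 0 -> s x^-1 = (s x)^-1.
Proof.
move=> x0; case: sP => _ sM sK; have xU := sfieldP _ x0.
have sxU : s x \is a GRing.unit.
  apply/sfieldP/eqP => sx0.
  by move: x0; rewrite -(sK x) sx0 antiaut0 eqxx.
by apply: (mulrI sxU); rewrite -sM mulVr// mulrV// antiaut1.
Qed.

End InvolutoryAntiautomorphism.

Section Hermitian.
Variables (F : sfieldType) (H : hermitianSpace F).
Implicit Types (u w : H) (a : F).

Lemma hform_scalel a u w : hs_form (a *: u) w = a * hs_form u w.
Proof.
by have := hs_forml a 0 u 0 w; rewrite scale0r addr0 mul0r addr0.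
Qed.

Lemma hform_scaler a u w : hs_form w (a *: u) = hs_form w u * hs_star H a.
Proof.
have := hs_formr a 0 u 0 w.
by rewrite scale0r addr0 (antiaut0 (hs_starP H)) mulr0 addr0.
Qed.

End Hermitian.

(** A synonym of [V] that records [sigma], so that the same additive group can carry a module
    structure over [F1] beside its original one over [F2]. *)
Definition restrict_scalars (F1 F2 : sfieldType) (sigma : {rmorphism F1 -> F2})
  (V : lmodType F2) : Type := V.

Section RestrictScalars.
Variables (F1 F2 : sfieldType) (sigma : {rmorphism F1 -> F2}).
Variable V : lmodType F2.
Local Notation W := (restrict_scalars sigma V).

HB.instance Definition _ := GRing.Zmodule.copy W V.

Let scale (a : F1) (u : W) : W := sigma a *: (u : V).

Let scaleA a b u : scale a (scale b u) = scale (a * b) u.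
Proof. by rewrite /scale scalerA rmorphM. Qed.

Let scale1 : left_id 1 scale.
Proof. by move=> u; rewrite /scale rmorph1 scale1r. Qed.

Let scaleDr : right_distributive scale +%R.
Proof. by move=> a u v; rewrite /scale scalerDr. Qed.

Let scaleDl u : {morph scale^~ u : a b / a + b}.
Proof. by move=> a b; rewrite /scale rmorphD scalerDl. Qed.

HB.instance Definition _ :=
  GRing.Zmodule_isLmodule.Build F1 W scaleA scale1 scaleDr scaleDl.

Lemma restrict_scalarsE a (u : W) : a *: u = sigma a *: (u : V) :> V.
Proof. by []. Qed.

End RestrictScalars.

(** * The twisted Hermitian space *)

Section Twist.
Variables (F1 F2 : sfieldType) (sigma : {rmorphism F1 -> F2}) (tau : F2 -> F1).
Hypotheses (sigmaK : cancel sigma tau) (tauK : cancel tau sigma).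
Variables (H : hermitianSpace F2) (lambda : F2).
Hypotheses (lambda0 : lambda != 0) (lambda_star : hs_star H lambda = lambda).
Local Notation W := (restrict_scalars sigma H).

Let lambdaU : lambda \is a GRing.unit := sfieldP _ lambda0.

Let lambdaV_star : hs_star H lambda^-1 = lambda^-1.
Proof. by rewrite (antiautV (hs_starP H))// lambda_star. Qed.

(** The form of [H] gets [lambda^-1] as a right factor, and a scalar leaving the second argument
    appears to the left of that factor. Moving it to the far right conjugates it by [lambda]. *)
Definition twist_star (a : F1) : F1 :=
  tau (lambda * hs_star H (sigma a) * lambda^-1).

Definition twist_form (u v : W) : F1 :=
  tau (hs_form (u : H) (v : H) * lambda^-1).

Let sigma_inj : injective sigma := can_inj sigmaK.

Lemma twist_starP : involutory_antiautomorphism twist_star.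
Proof.
have [sD sM sK] := hs_starP H; split=> [a b|a b|a]; apply: sigma_inj.
- by rewrite rmorphD /twist_star !tauK rmorphD sD mulrDr mulrDl.
- by rewrite rmorphM /twist_star !tauK rmorphM sM !mulrA mulrVK.
(* As [lambda] is fixed by the involution, the inner conjugation by [lambda] turns into one by
   [lambda^-1], which the outer one undoes. *)
- rewrite /twist_star !tauK !sM sK lambdaV_star lambda_star.
  by rewrite !mulrA mulrV// mul1r mulrK.
Qed.

Lemma twist_forml (a b : F1) (u v w : W) :
  twist_form (a *: u + b *: v) w = a * twist_form u w + b * twist_form v w.
Proof.
apply: sigma_inj; rewrite rmorphD !rmorphM /twist_form !tauK.
by rewrite !mulrA -mulrDl -hs_forml.
Qed.

Lemma twist_formr (a b : F1) (u v w : W) :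
  twist_form w (a *: u + b *: v) =
    twist_form w u * twist_star a + twist_form w v * twist_star b.
Proof.
apply: sigma_inj; rewrite rmorphD !rmorphM /twist_form /twist_star !tauK.
by rewrite !mulrA !mulrVK// -mulrDl -hs_formr.
Qed.

Lemma twist_formC (u v : W) : twist_form u v = twist_star (twist_form v u).
Proof.
have [_ sM _] := hs_starP H; rewrite /twist_star /twist_form tauK.
by rewrite sM lambdaV_star !mulrA mulrV// mul1r -hs_formC.
Qed.

Lemma twist_form_eq0 (u v : W) :
  twist_form u v = 0 <-> hs_form (u : H) (v : H) = 0.
Proof.
split=> [|uv]; last by apply: sigma_inj; rewrite /twist_form tauK uv mul0r rmorph0.
move=> /(congr1 sigma); rewrite /twist_form tauK rmorph0 => uv.
by rewrite -(mulrVK lambdaU (hs_form _ _)) uv mul0r.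
Qed.

Lemma twist_anisotropic (u : W) : twist_form u u = 0 -> u = 0.
Proof. by move=> /twist_form_eq0/hs_anisotropic. Qed.

Lemma twist_countable (A : set W) :
  (forall u, A u -> u <> 0) ->
  (forall u v, A u -> A v -> u <> v -> twist_form u v = 0) -> countable A.
Proof.
move=> A0 Ao; apply: (@hs_countable _ H A A0) => u v Au Av uv.
exact/twist_form_eq0/Ao.
Qed.

Definition twist : hermitianSpace F1 :=
  HermitianSpace twist_starP twist_forml twist_formr twist_formC
    twist_anisotropic twist_countable.

Lemma twist_horth (u v : H) : @horth _ twist u v <-> horth u v.
Proof. exact: twist_form_eq0. Qed.

Lemma twist_orthocomp (S : set H) : @orthocomp _ twist S = orthocomp S.
Proof.
by apply/seteqP; split=> u Su v Sv; apply/twist_horth/Su.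
Qed.

Lemma twist_linear_subspace (S : set H) :
  @linear_subspace _ twist S <-> linear_subspace S.
Proof.
split=> -[S0 Sl]; split=> // a b u v Su Sv; last exact: (Sl (sigma a) (sigma b)).
(* Every scalar of [F2] is in the image of [sigma], so closure under scalars from [F1] is enough. *)
by have := Sl (tau a) (tau b) _ _ Su Sv; rewrite !restrict_scalarsE !tauK.
Qed.

Lemma twist_orthoclosed (S : set H) : @orthoclosed _ twist S <-> orthoclosed S.
Proof.
by rewrite /orthoclosed !twist_orthocomp; split=> -[/twist_linear_subspace].
Qed.

Lemma twist_orthomodular : orthomodular H -> orthomodular twist.
Proof.
move=> om S /twist_orthoclosed/om[SI Sdec].
by split; rewrite twist_orthocomp.
Qed.

Lemma twist_hspan (u : H) : @hspan _ twist u = hspan u.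
Proof.
apply/seteqP; split=> [_ [a _ <-]|_ [a _ <-]]; first by exists (sigma a).
by exists (tau a) => //; rewrite restrict_scalarsE tauK.
Qed.

Let proj_twist (L : set H) :
  (exists u, L = hspan u) -> exists u : twist, L = @hspan _ twist u.
Proof. by move=> [u ->]; exists u; rewrite twist_hspan. Qed.

Let twist_proj (L : set H) :
  (exists u : twist, L = @hspan _ twist u) -> exists u, L = hspan u.
Proof. by move=> [u ->]; exists u; rewrite -twist_hspan. Qed.

(** The identity on underlying sets: both spaces have the same lines, and only the proof component
    of the pair changes. *)
Definition to_twist (x : PP H) : PP twist :=
  exist (fun L : set twist => exists u, L = hspan u) (sval x)
    (proj_twist (svalP x)).

Definition of_twist (x : PP twist) : PP H :=
  exist (fun L : set H => exists u, L = hspan u) (sval x)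
    (twist_proj (svalP x)).

Lemma to_twist_ray (u : H) : to_twist (ray u) = @ray _ twist u.
Proof. by apply: eq_exist; rewrite twist_hspan. Qed.

Lemma of_twist_ray (u : H) : of_twist (@ray _ twist u) = ray u.
Proof. by apply: eq_exist; rewrite -twist_hspan. Qed.

Lemma to_twistK : cancel to_twist of_twist.
Proof. by move=> x; have [u ->] := proj_ray x; rewrite to_twist_ray of_twist_ray. Qed.

Lemma of_twistK : cancel of_twist to_twist.
Proof. by move=> x; have [u ->] := proj_ray x; rewrite of_twist_ray to_twist_ray. Qed.

Lemma to_twist_orthoisomorphism : orthoisomorphism to_twist.
Proof.
split; first by exists of_twist; [exact: to_twistK|exact: of_twistK].
move=> x y; split=> [[u [v [-> -> /twist_horth uv]]]|[u [v [xu yv uv]]]].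
  by exists u, v; rewrite !to_twist_ray.
exists u, v; split; last exact/twist_horth.
  by rewrite -(to_twistK x) xu of_twist_ray.
by rewrite -(to_twistK y) yv of_twist_ray.
Qed.

End Twist.

(** * Symmetry of the factor, and the partial isometry *)

Lemma quasiunitary_lambda_star (F1 F2 : sfieldType) (H1 : hermitianSpace F1)
    (H2 : hermitianSpace F2) (S1 : set H1) (S2 : set H2)
    (sigma : {rmorphism F1 -> F2}) (lambda : F2) (phi : H1 -> H2) (u : H1) :
  linear_subspace S1 -> lambda != 0 ->
  quasiunitary_on_for S1 S2 sigma lambda phi ->
  S1 u -> u <> 0 -> hs_star H2 lambda = lambda.
Proof.
move=> [S0 Sl] l0 [_ [[tau sK _] _ phiZ] form] Su u0.
have lU := sfieldP _ l0; have [_ s2M _] := hs_starP H2.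
set c := sigma (hs_form u u).
have cU : c \is a GRing.unit.
  apply/sfieldP/eqP => c0; apply/u0/hs_anisotropic/(can_inj sK).
  by rewrite rmorph0.
(* Two values of the form at [phi u] and [phi (a *: u)], with the common left factor [c]
   cancelled. *)
have star a : lambda * hs_star H2 (sigma a) = sigma (hs_star H1 a) * lambda.
  have Sau : S1 (a *: u) by have := Sl a 0 u 0 Su S0; rewrite scale0r addr0.
  have := form _ _ Su Sau; rewrite phiZ// !hform_scaler form// rmorphM.
  by rewrite -!mulrA => /(mulrI cU).
(* The form of [H2] at [(phi u, phi u)] is fixed by the involution. *)
have cl : c * lambda = hs_star H2 lambda * hs_star H2 c.
  by rewrite -s2M /c -form// -hs_formC.
(* This is [star] at [a = hs_form u u], which the involution of [H1] fixes. *)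
have lc : lambda * hs_star H2 c = c * lambda by rewrite star -hs_formC.
have scU : hs_star H2 c \is a GRing.unit.
  by rewrite -(unitrMr _ lU) lc unitrMl.
by apply: (mulIr scU); rewrite -cl lc.
Qed.

Lemma partial_quasiisometry_twist (F1 F2 : sfieldType) (H1 : hermitianSpace F1)
    (H2 : hermitianSpace F2) (phi : H1 -> H2) (sigma : {rmorphism F1 -> F2})
    (tau : F2 -> F1) (sigmaK : cancel sigma tau) (tauK : cancel tau sigma)
    (lambda : F2) (l0 : lambda != 0) (ls : hs_star H2 lambda = lambda)
    (S1 : set H1) (S2 : set H2) :
  orthomodular H1 -> quasilinear phi -> orthoclosed S1 -> orthoclosed S2 ->
  [set u | phi u = 0] = orthocomp S1 -> range phi = S2 ->
  quasiunitary_on_for S1 S2 sigma lambda phi ->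
  @partial_isometry F1 H1 (twist sigmaK tauK l0 ls) phi.
Proof.
move=> om [rho [_ phiD phiZ]] c1 c2 k1 i2 [bij [_ _ phiZ1] form].
have [_ dec] := om _ c1; have [[S0 Sl] _] := c1.
(* The isomorphism [rho] of [phi] on [H1] and the isomorphism [sigma] of its restriction to [S1] are
   not assumed equal. Since [S1] splits [H1] and [phi] kills the component in its orthocomplement,
   [sigma] serves on all of [H1]. *)
have phiZs a u : phi (a *: u) = sigma a *: phi u.
  have [s [k [Ss]]] := dec u; rewrite -k1 => /= k0 ->.
  by rewrite scalerDr !phiD// phiZ1// phiZ// k0 scaler0 !addr0.
split=> [a u v|]; first by rewrite phiD// phiZs.
exists S1, S2; split=> //; first exact/twist_orthoclosed.
split=> //; first split.
- by exists idfun.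
- by move=> u v _ _; exact: phiD.
- by move=> a u _; exact: phiZs.
- move=> u v Su Sv; rewrite mulr1 /= /twist_form form//.
  by rewrite (mulrK (sfieldP _ l0)) sigmaK.
Qed.

Theorem lemma6p7 (F1 F2 : sfieldType)
    (H1 : hermitianSpace F1) (H2 : hermitianSpace F2)
    (omH1 : orthomodular H1) (omH2 : orthomodular H2)
    (phi : H1 -> H2) (phiP : partial_quasiisometry phi) :
  let f : PP H1 -> PP H2 := PPmap (proj1 phiP) in
  exists (H2' : hermitianSpace F1) (t : PP H2 -> PP H2'),
    [/\ orthomodular H2', orthoisomorphism t &
        exists phi' : H1 -> H2',
          partial_isometry phi' /\
          forall u : H1, t (f (ray u)) = ray (phi' u)].
Proof.
move=> f; have [S1 [S2 [c1 c2 k1 i2 [sigma [l [l0 uS]]]]]] := proj2 phiP.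
have [mu [mu0 [mus uS']]] : exists mu : F2, mu != 0 /\
    (hs_star H2 mu = mu /\ quasiunitary_on_for S1 S2 sigma mu phi).
  have [[u [Su u0]]|S10] := pselect (exists u, S1 u /\ u <> 0).
    exists l; split=> //; split=> //.
    exact: quasiunitary_lambda_star (proj1 c1) l0 uS Su u0.
  exists 1; split; first exact: oner_neq0.
  split; first exact: antiaut1 (hs_starP H2).
  (* On the zero subspace both sides of the form identity vanish, whatever the factor. *)
  case: uS => bij lin form; split=> // u v Su Sv.
  have u0 : u = 0 by apply: contrapT => u0; apply: S10; exists u.
  by rewrite form// u0 hform0l rmorph0 !mul0r.
have [_ [[tau sK tK] _ _] _] := uS'.
exists (twist sK tK mu0 mus), (to_twist sK tK mu0 mus); split.
- exact: twist_orthomodular.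
- exact: to_twist_orthoisomorphism.
- exists phi; split; last by move=> u; rewrite /f PPmap_ray to_twist_ray.
  exact: partial_quasiisometry_twist omH1 (proj1 phiP) c1 c2 k1 i2 uS'.
Qed.
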